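(* Assume: (h) $\mathsf A$ is an infinite compact subset of $\mathbb R^d$ for some $d\ge1$; (j) $c$ is bounded and there is $K_1\ge0$ with $|c(x,\tilde a)-c(x,a)|\le K_1 d_{\mathsf A}(\tilde a,a)$ for all $x\in\mathsf X$ and $a,\tilde a\in\mathsf A$; (k) there is $K_2\ge0$ with $\|p(\,\cdot\,|x,\tilde a)-p(\,\cdot\,|x,a)\|_{TV}\le K_2 d_{\mathsf A}(\tilde a,a)$ for all $x\in\mathsf X$ and $a,\tilde a\in\mathsf A$. Let $\pi\in RS$ and let $\{\pi^k\}_{k\ge1}$ be the quantized approximations of $\pi$. Put $M:=\sup_{(x,a)\in\mathsf X\times\mathsf A}|c(x,a)|$. (1) For every $\beta\in(0,1)$, any initial distribution $\mu$ and all $k\ge1$, $$|w_\beta(\pi,\mu)-w_\beta(\pi^k,\mu)|\le K(1/k)^{1/d},\qquad K=\frac{\alpha}{1-\beta}\Big(K_1-\beta K_2M+\frac{2\beta MK_2}{1-\beta}\Big).$$ (2) If in addition ($\tilde l$) there exist constants $C>0$ and $\kappa\in(0,1)$ such that for every $\tilde\pi\in RS$ there is a (necessarily unique) probability measure $\nu_{\tilde\pi}$ on $\mathsf X$ with $\|\lambda_n^{\tilde\pi,x}-\nu_{\tilde\pi}\|_{TV}\le C\kappa^n$ for all $x\in\mathsf X$ and $n\ge1$, then for all $x\in\mathsf X$, all $k\ge1$ and all $n\ge1$, $$|w_A(\pi,x)-w_A(\pi^k,x)|\le 2MC\kappa^n+\big((2n-1)K_2\alpha M+K_1\alpha\bi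g)(1/k)^{1/d}.$$
   Context: Markov decision process: the state space $\mathsf X$ is a Polish space with its Borel $\sigma$-algebra, the action space $\mathsf A$ is as in (h); every action is admissible in every state; $p(\,\cdot\,|x,a)$ is a stochastic kernel on $\mathsf X$ given $\mathsf X\times\mathsf A$ (transition probability); the one-stage cost $c:\mathsf X\times\mathsf A\to[0,\infty)$ is measurable. ''Measurable'' means Borel measurable. $d_{\mathsf A}$ is the Euclidean distance on $\mathsf A$ inherited from $\mathbb R^d$. $\|\cdot\|_{TV}$ is the total variation norm; for probability measures, $\|\nu-\eta\|_{TV}=2\sup_{B}|\nu(B)-\eta(B)|$. $RS$ is the set of randomized stationary policies: $\pi\in RS$ is given (induced) by a stochastic kernel $\eta(da|x)$ on $\mathsf A$ given $\mathsf X$, and at each time $n$ the action $a_n$ has conditional law $\eta(\,\cdot\,|x_n)$ given the past. $E^\pi_\mu$ is expectation for the process $(x_0,a_0,x_1,a_1,\dots)$ with $x_0\sim\mu$, actions chosen by $\pi$, and $x_{n+1}\sim p(\,\cdot\,|x_n,a_n)$ given the past; $\lambda_n^{\pi,x}$ is the law of $x_n$ when $x_0=x$. Costs: $w_\beta(\pi,\mu)=E^\pi_\mu[\sum_{n=0}^\infty\beta^nc(x_n,a_n)]$ and $w_A(\pi,x)=\limsup_{N\to\infty}\frac1NE^\pi_{\delta_x}[\sum_{n=0}^Nc(x_n,a_n)]$. Quantized approximations and the constant $\alpha$: since $\mathsf A$ is an infinite compact subset of $\mathbb R^d$, there are a constant $\alpha>0$ and finite sets $\Lambda_k\subset\mathsf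 A$ with $|\Lambda_k|=k$ such that $\max_{x\in\mathsf A}\min_{y\in\Lambda_k}d_{\mathsf A}(x,y)\le\alpha(1/k)^{1/d}$ for all $k\ge1$; fix such $\alpha$ and $\Lambda_k$. Let $\pi\in RS$ be induced by $\eta$. There is a measurable $\mathsf f:\mathsf X\times[0,1]\to\mathsf A$ with $\eta(E|x)=m(\{z:\mathsf f(x,z)\in E\})$ for all Borel $E\subset\mathsf A$, where $m$ is Lebesgue measure on $[0,1]$; fix such an $\mathsf f$. Let $\mathsf q_k:\mathsf X\times[0,1]\to\Lambda_k$, $\mathsf q_k(x,z)=\arg\min_{a\in\Lambda_k}d_{\mathsf A}(\mathsf f(x,z),a)$, with ties broken so that $\mathsf q_k$ is (jointly) measurable. The $k$-th quantized approximation $\pi^k\in RS$ of $\pi$ is the policy induced by the stochastic kernel $\eta_k(\,\cdot\,|x)=\int_{[0,1]}\delta_{\mathsf q_k(x,z)}(\,\cdot\,)\,m(dz)$. *)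

(* Defs.v *)
From HB Require Import structures.
From mathcomp Require Import all_boot all_order all_algebra.
From mathcomp Require Import all_classical all_reals all_analysis.

Set Implicit Arguments.
Unset Strict Implicit.
Unset Printing Implicit Defensive.

Import Order.TTheory GRing.Theory Num.Theory.
Import numFieldNormedType.Exports.

Local Open Scope classical_set_scope.
Local Open Scope ring_scope.

(* The metric is existentially quantified: only the topology of a Polish space
   is part of the data. Nonnegativity of dist follows from the listed axioms. *)
Definition polish_space (R : realType) (T : topologicalType) : Prop :=
  (exists2 D : set T, countable D & dense D) /\
  exists dist : T -> T -> R,
    [/\ forall x y, dist x y = 0 <-> x = y,
        forall x y, dist x y = dist y x,
        forall x y z, dist x z <= dist x y + dist y z,
        forall (x : T) (U : set T), nbhs x U <->
          exists2 e : R, 0 < e & [set y | dist x y < e] `<=` U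
      & forall u : nat -> T,
          (forall e : R, 0 < e -> exists N : nat, forall m n : nat,
             (N <= m)%N -> (N <= n)%N -> dist (u m) (u n) < e) ->
          exists l : T, u @ \oo --> l].

Notation borel T := (g_sigma_algebraType (@open T)).

Definition eucl_dist (R : realType) (d : nat) (x y : 'rV[R]_d) : R :=
  Num.sqrt (\sum_(i < d) (x ord0 i - y ord0 i) ^+ 2).

Section subset_space.
Context (R : realType) (d : nat) (A : set 'rV[R]_d).

(* A as a type, with the topology inherited from R^d. The library requires
   measurable types to be pointed; infinitude of A provides the point. *)
Definition subset_space (Ainf : infinite_set A) : Type := set_type A.

Context (Ainf : infinite_set A).

Lemma subset_space_inhabited : exists x : 'rV[R]_d, x \in A.
Proof.
have /set0P[x Ax] : A != set0.
  by apply/eqP => A0; apply: Ainf; rewrite A0.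
by exists x; apply/mem_set.
Qed.

HB.instance Definition _ := Topological.on (subset_space Ainf).
HB.instance Definition _ := isPointed.Build (subset_space Ainf)
  (exist _ _ (projT2 (cid subset_space_inhabited))).

Definition dist_sub (a b : subset_space Ainf) : R :=
  eucl_dist (\val a) (\val b).

End subset_space.

Arguments dist_sub {R d A} Ainf a b.

Definition tv_dist (R : realType) (dT : measure_display)
    (T : measurableType dT) (nu eta : set T -> \bar R) : \bar R :=
  (2%:E * ereal_sup [set `|nu B - eta B| | B in [set B | measurable B]])%E.

Section mdp.
Context (R : realType) (dX dA : measure_display).
Context (X : measurableType dX) (A : measurableType dA).

(* The sigma-algebra generated by x_i, i < m, and a_j, j < n. *)
Definition history (W : Type) (x : nat -> W -> X) (a : nat -> W -> A)
    (m n : nat) : set (set W) :=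
  <<s [set E | (exists i B, [/\ (i < m)%N, measurable B & E = x i @^-1` B])
            \/ (exists j B, [/\ (j < n)%N, measurable B & E = a j @^-1` B])] >>.

(* A state-action process, on some probability space, with initial law mu,
   controlled by the randomized stationary policy given by the kernel eta.
   Such a process exists by the Ionescu-Tulcea theorem, and these conditions
   determine its joint law, so every expectation below depends only on p, eta
   and mu. *)
Record controlled_process (p : R.-pker (X * A)%type ~> X)
    (eta : R.-pker X ~> A) (mu : probability X R) := ControlledProcess {
  cp_display : measure_display;
  cp_space : measurableType cp_display;
  cp_prob : probability cp_space R;
  cp_state : nat -> {mfun cp_space >-> X};
  cp_action : nat -> {mfun cp_space >-> A};
  cp_init : forall B : set X, measurable B ->
    cp_prob (cp_state 0%N @^-1` B) = mu B;
  cp_action_law : forall (n : nat) (H : set cp_space) (B : set A),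
    history cp_state cp_action n.+1 n H -> measurable B ->
    cp_prob (H `&` cp_action n @^-1` B) =
      (\int[cp_prob]_(w in H) eta (cp_state n w) B)%E;
  cp_state_law : forall (n : nat) (H : set cp_space) (B : set X),
    history cp_state cp_action n.+1 n.+1 H -> measurable B ->
    cp_prob (H `&` cp_state n.+1 @^-1` B) =
      (\int[cp_prob]_(w in H) p (cp_state n w, cp_action n w) B)%E
}.

Context (p : R.-pker (X * A)%type ~> X) (eta : R.-pker X ~> A).
Context (mu : probability X R).

Definition state_law (S : controlled_process p eta mu) (n : nat) :
    probability X R :=
  distribution (cp_prob S) (cp_state S n).

Definition w_beta (c : X * A -> R) (beta : R)
    (S : controlled_process p eta mu) : \bar R :=
  (\int[cp_prob S]_w
     \sum_(0 <= n <oo) (beta ^+ n * c (cp_state S n w, cp_action S n w))%:E)%E.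

Definition w_A (c : X * A -> R) (S : controlled_process p eta mu) : \bar R :=
  limn_esup (fun N : nat => ((N%:R^-1)%:E *
    \int[cp_prob S]_w
      (\sum_(0 <= n < N.+1) c (cp_state S n w, cp_action S n w))%:E)%E).

End mdp.

Section quantization.
Context (R : realType) (dX : measure_display) (X : measurableType dX).
Context (d : nat) (A : set 'rV[R]_d) (Ainf : infinite_set A).
Local Notation Act := (borel (subset_space Ainf)).
Local Notation I01 := (`[0%R, 1%R]%classic : set R).

Definition quantization_nets (alpha : R) (Lambda : nat -> set Act) : Prop :=
  forall k : nat, (1 <= k)%N ->
    (Lambda k #= `I_k)%card /\
    forall a : Act, exists2 b, Lambda k b &
      dist_sub Ainf a b <= alpha * (1 / k%:R) `^ (1 / d%:R).

(* f is only constrained on X x [0,1]; its values elsewhere are irrelevant. *)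
Definition represents (f : X * measurableTypeR R -> Act)
    (eta : R.-pker X ~> Act) : Prop :=
  measurable_fun ([set: X] `*` I01) f /\
  forall x (E : set Act), measurable E ->
    eta x E = lebesgue_measure [set z | I01 z /\ E (f (x, z))].

Definition quantizer (L : set Act) (f q : X * measurableTypeR R -> Act) : Prop :=
  measurable_fun ([set: X] `*` I01) q /\
  forall x z, I01 z ->
    L (q (x, z)) /\
    forall b, L b -> dist_sub Ainf (f (x, z)) (q (x, z)) <= dist_sub Ainf (f (x, z)) b.

Definition induced_by (q : X * measurableTypeR R -> Act)
    (eta : R.-pker X ~> Act) : Prop :=
  forall x (E : set Act), measurable E ->
    eta x E = (\int[lebesgue_measure]_(z in I01) \d_(q (x, z)) E)%E.

End quantization.

(* Main.v *)
Require Import Defs.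
From HB Require Import structures.
From mathcomp Require Import all_boot all_order all_algebra.
From mathcomp Require Import all_classical all_reals all_analysis.
From mathcomp Require Import measurable_realfun.
From mathcomp Require Import ring lra.

Set Implicit Arguments.
Unset Strict Implicit.
Unset Printing Implicit Defensive.

Import Order.TTheory GRing.Theory Num.Theory.
Import numFieldNormedType.Exports.

Local Open Scope classical_set_scope.
Local Open Scope ring_scope.

(** Both policies draw their actions from the same source of randomness.
With z uniform on [0,1], the action f(x,z) has law eta(.|x) and q_k(x,z) has
law eta_k(.|x), and for every pair (x,z) these two actions are at distance at
most rho = alpha (1/k)^(1/d), since q_k(x,z) is a nearest point of the net.
The law of (x_n,a_n) is the image of (law of x_n) * (uniform law) under
(x,z) |-> (x,f(x,z)) ([state_action_law]); hence a function of (x_n,a_n) is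
integrated by averaging first over z and then over x_n
([integral_state_action]).

Suppose that the laws of x_n under the two policies differ by at most delta on
every set. For g with values in [0,M] that moves by at most e when the action
is replaced by its quantization, the two expectations of g(x_n,a_n) differ by
at most M delta + e ([state_action_mean_le]): averaging over z costs e, and
changing the law of x_n costs M delta by the layer cake formula
([le_integral_setwise]). For g = p(B|.), with M = 1 and e = K2 rho / 2, this
bounds the discrepancy at time n+1 by the one at time n plus K2 rho / 2, so it
is at most n K2 rho / 2 at time n ([state_law_le]). For g = c it bounds
the difference of the expected costs at time n by M n K2 rho / 2 + K1 rho
([stage_cost_close]).

The discounted bound is the sum of these differences with weights beta^n,
using sum_n n beta^n = beta / (1-beta)^2. For the average cost, ergodicity
makes the expected cost at time n converge geometrically; its limit is the
Cesaro limit, that is, the average cost ([ergodic_cost]). So both average costs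
may be replaced by the expected costs at one time n, at the price of
M C kappa^n / 2 each. The factors 1/2 from the normalization of the total
variation leave room in the final constants. *)

(** * Expectations of bounded functions under close laws *)

Section bounded_integrands.
Context (R : realType) (dT : measure_display) (T : measurableType dT).
Local Open Scope ereal_scope.

(** By the layer cake formula the integral of G is the integral of the tail
P(G > r) over r >= 0; the tails differ by at most delta, and only r in [0,M]
contributes. *)
Lemma le_integral_setwise (P Q : probability T R) (delta M : R)
    (G : T -> \bar R) :
  (0 <= delta)%R -> (forall B, measurable B -> P B <= Q B + delta%:E) ->
  measurable_fun [set: T] G -> (forall x, 0 <= G x <= M%:E) ->
  \int[P]_x G x <= \int[Q]_x G x + (M * delta)%:E.
Proof.
move=> delta0 PQ mG G0M.
have M0 : (0 <= M)%R.
  by rewrite -lee_fin; have /andP[/le_trans] := G0M point; exact.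
have Gfin x : G x \is a fin_num.
  have /andP[G0 GM] := G0M x.
  by rewrite ge0_fin_numE//; exact: le_lt_trans GM (ltry _).
pose g x := fine (G x).
have mg : measurable_fun [set: T] g by apply: measurableT_comp.
pose gf : {mfun T >-> R} := HB.pack g (isMeasurableFun.Build _ _ _ _ _ mg).
have g0 x : (0 <= gf x)%R by apply: fine_ge0; have /andP[] := G0M x.
have gM x : (gf x <= M)%R.
  by rewrite -lee_fin fineK//; have /andP[] := G0M x.
have layer (P' : probability T R) : \int[P']_x G x =
    \int[lebesgue_measure]_(r in `[0%R, +oo[) ccdf (P := P') gf r.
  rewrite -ge0_expectation_ccdf// expectation_def.
  by apply: eq_integral => x _; rewrite /= fineK.
have mI : measurable (`[0%R, M] : set R) by exact: measurable_itv.
(* h bounds the difference of the tails: they both vanish for r > M. *)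
pose h (r : R) : \bar R := (delta * \1_(`[0%R, M] : set R) r)%:E.
have mh : measurable_fun (`[0%R, +oo[ : set R) h.
  by apply: measurable_funTS; apply/measurable_EFinP; apply: measurable_funM.
rewrite !layer.
apply: (@le_trans _ _ (\int[lebesgue_measure]_(r in `[0%R, +oo[)
   (ccdf (P := Q) gf r + h r))).
  apply: ge0_le_integral => //.
  - by apply: measurable_funTS; exact: ccdf_measurable.
  - apply: emeasurable_funD => //.
    by apply: measurable_funTS; exact: ccdf_measurable.
  - move=> r /=; rewrite in_itv/= andbT => r0.
    rewrite /h indicE; case: (boolP (r \in _)) => rM /=.
      rewrite mulr1; apply: PQ.
      exact: (measurable_funPTI gf).
    rewrite /ccdf /distribution /pushforward mulr0 adde0.
    rewrite (_ : gf @^-1` _ = set0) ?measure0//.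
    rewrite -subset0 => x /=; rewrite in_itv/= andbT => rg.
    move: rM; rewrite notin_setE/= in_itv/= r0/=; apply.
    by rewrite (le_trans (ltW rg)).
rewrite ge0_integralD//; last 2 first.
- by apply: measurable_funTS; exact: ccdf_measurable.
- by move=> r _; rewrite lee_fin mulr_ge0.
rewrite leeD2l// /h.
under eq_integral do rewrite EFinM.
rewrite ge0_integralZl//; last first.
- by apply: measurable_funTS; exact/measurable_EFinP.
rewrite integral_indic//= (_ : _ `&` _ = `[0%R, M]%classic); last first.
  apply/setIidl => r /=; rewrite !in_itv/= andbT.
  by case/andP.
rewrite lebesgue_measure_itv/= lte_fin.
case: ltP => M0'; first by rewrite sube0 -EFinM mulrC lexx.
by rewrite mule0 lee_fin mulr_ge0.
Qed.

(** The halving undoes the factor 2 in the normalization of the total variation;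
it is stated for set functions so that it applies to the values of a kernel. *)
Lemma tv_dist_setwise (P Q : set T -> \bar R) (delta : R) (B : set T) :
  P B \is a fin_num -> Q B \is a fin_num ->
  tv_dist P Q <= (2 * delta)%:E -> measurable B ->
  P B <= Q B + delta%:E /\ Q B <= P B + delta%:E.
Proof.
move=> /fineK PB /fineK QB tvPQ mB.
have : 2%:E * `|P B - Q B| <= (2 * delta)%:E.
  apply: le_trans tvPQ; rewrite /tv_dist lee_pmul2l//.
  by apply: ereal_sup_ubound; exists B.
rewrite -PB -QB -EFinM -!EFinD !lee_fin ler_pM2l// ler_norml.
by case/andP=> ? ?; split; lra.
Qed.

(** Two inequalities without subtraction are easier to obtain in the extended
reals; finiteness of y is what rules out the difference of two infinities. *)
Lemma lee_abse_sub (x y : \bar R) (e : R) : y \is a fin_num -> 0 <= x ->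
  x <= y + e%:E -> y <= x + e%:E -> `|x - y| <= e%:E.
Proof.
move: x y => [x| |] [y| |]//= _ _; rewrite -!EFinD !lee_fin => xy yx.
by rewrite ler_norml; apply/andP; split; lra.
Qed.

End bounded_integrands.

(** * Policies driven by an independent noise *)

Section noise.
Context (R : realType) (dX dA dZ : measure_display).
Context (X : measurableType dX) (A : measurableType dA) (Z : measurableType dZ).
Context (m : probability Z R) (p : R.-pker (X * A)%type ~> X).
Local Open Scope ereal_scope.

(** The policy eta is simulated by playing f(x,z), where z is drawn from m. *)
Definition noise_map (f : X * Z -> A) (eta : R.-pker X ~> A) : Prop :=
  measurable_fun setT f /\
  forall x E, measurable E -> eta x E = m [set z | E (f (x, z))].

(** The integral of g(x,.) with respect to eta(.|x) when f simulates eta. *)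
Definition noise_mean (f : X * Z -> A) (g : X * A -> \bar R) (x : X) : \bar R :=
  \int[m]_z g (x, f (x, z)).

Lemma measurable_state_noise (f : X * Z -> A) : measurable_fun setT f ->
  measurable_fun setT (fun u : X * Z => (u.1, f u)).
Proof. by move=> mf; apply: measurable_fun_pair. Qed.

Lemma measurable_noise_mean (f : X * Z -> A) (g : X * A -> \bar R) :
  measurable_fun setT f -> measurable_fun setT g -> (forall u, 0 <= g u) ->
  measurable_fun setT (noise_mean f g).
Proof.
move=> mf mg g0.
apply: (@measurable_fun_fubini_tonelli_F _ _ X Z R m
  (fun u => g (u.1, f u))) => //.
exact: measurableT_comp mg (measurable_state_noise mf).
Qed.

Lemma noise_mean_bounds (f : X * Z -> A) (g : X * A -> \bar R) (M : R) x :
  measurable_fun setT f -> measurable_fun setT g ->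
  (forall u, 0 <= g u <= M%:E) -> 0 <= noise_mean f g x <= M%:E.
Proof.
move=> mf mg g0M; apply/andP; split.
  by apply: integral_ge0 => z _; have /andP[] := g0M (x, f (x, z)).
apply: (@le_trans _ _ (\int[m]_z (cst M%:E z))); last first.
  by rewrite integral_cst// [X in _ * X]probability_setT mule1.
apply: ge0_le_integral => //.
- by move=> z _; have /andP[] := g0M (x, f (x, z)).
- apply: (measurableT_comp mg); apply: measurable_fun_pair => //.
  by apply: (measurableT_comp mf); exact: pair1_measurable.
- by move=> z _; have /andP[] := g0M (x, f (x, z)).
Qed.

Section one_process.
Context (eta : R.-pker X ~> A) (mu : probability X R).
Context (S : controlled_process p eta mu).
Context (f : X * Z -> A) (f_eta : noise_map f eta).

Let state_action n w := (cp_state S n w, cp_action S n w).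

Let measurable_state_action n : measurable_fun setT (state_action n).
Proof. by apply: measurable_fun_pair. Qed.

(** Both sides are finite measures of U. On a rectangle D x E they agree: each
is the integral of eta(E|x) over x in D against the law of x_n. *)
Lemma state_action_law n (U : set (X * A)) : measurable U ->
  cp_prob S (state_action n @^-1` U) =
  (state_law S n \x m) ((fun u => (u.1, f u)) @^-1` U).
Proof.
have [mf etaE] := f_eta.
pose s1 : {mfun _ >-> (X * A)%type} := HB.pack (state_action n)
  (isMeasurableFun.Build _ _ _ _ _ (@measurable_state_action n)).
pose s2 : {mfun _ >-> (X * A)%type} := HB.pack (fun u : X * Z => (u.1, f u))
  (isMeasurableFun.Build _ _ _ _ _ (measurable_state_noise mf)).
move=> mU.
apply: (@measure_unique _ R (X * A)%type
  [set D `*` E | D in measurable & E in measurable] (fun=> setT) _ _ _ _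
  (pushforward (cp_prob S) s1) (pushforward (state_law S n \x m) s2)) => //.
- exact: measurable_prod_measurableType.
- move=> _ _ [D mD [E mE <-]] [D' mD' [E' mE' <-]].
  exists (D `&` D'); first exact: measurableI.
  by exists (E `&` E'); [exact: measurableI|rewrite setXI].
- by move=> _; exists setT => //; exists setT => //; rewrite setXTT.
- by rewrite bigcup_const//; exists 0%N.
- move=> _ [D mD [E mE <-]].
  transitivity (cp_prob S (cp_state S n @^-1` D `&` cp_action S n @^-1` E)).
    by [].
  rewrite cp_action_law//; last first.
    by apply: sub_sigma_algebra; left; exists n, D.
  transitivity (\int[state_law S n]_(x in D) eta x E).
    apply/esym; apply: ge0_integral_pushforward => //.
    by apply: measurable_funTS; exact: measurable_kernel.
  rewrite integral_mkcond; apply: eq_integral => x _.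
  rewrite /= patchE; case: ifPn => [xD|xD].
    rewrite etaE//; congr (m _); apply/seteqP; split => z /=.
      by move=> Ez; rewrite /xsection/= inE; split => //=; rewrite inE in xD.
    by rewrite /xsection/= inE => -[].
  rewrite (_ : xsection _ x = set0) ?measure0// -subset0 => z.
  by rewrite /xsection/= inE => -[/= Dx _]; move: xD; rewrite notin_setE.
- by move=> _; rewrite -[X in X < _]/(cp_prob S setT) probability_setT ltry.
Qed.

Lemma integral_state_action n (g : X * A -> \bar R) :
  measurable_fun setT g -> (forall u, 0 <= g u) ->
  \int[cp_prob S]_w g (cp_state S n w, cp_action S n w) =
  \int[state_law S n]_x noise_mean f g x.
Proof.
move=> mg g0; have [mf _] := f_eta.
pose s1 : {mfun _ >-> (X * A)%type} := HB.pack (state_action n)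
  (isMeasurableFun.Build _ _ _ _ _ (@measurable_state_action n)).
pose s2 : {mfun _ >-> (X * A)%type} := HB.pack (fun u : X * Z => (u.1, f u))
  (isMeasurableFun.Build _ _ _ _ _ (measurable_state_noise mf)).
transitivity (\int[pushforward (cp_prob S) s1]_u g u).
  by rewrite ge0_integral_pushforward.
transitivity (\int[pushforward (state_law S n \x m) s2]_u g u).
  by apply: eq_measure_integral => U mU _; exact: state_action_law.
rewrite ge0_integral_pushforward//.
apply: (@fubini_tonelli1 _ _ X Z R (state_law S n) m
  (fun u => g (u.1, f u))) => //.
exact: measurableT_comp mg (measurable_state_noise mf).
Qed.

(** The transition law, conditioned on the trivial event. *)
Lemma state_law_next n (B : set X) : measurable B ->
  state_law S n.+1 B = \int[state_law S n]_x noise_mean f (fun u => p u B) x.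
Proof.
move=> mB; rewrite -integral_state_action//; last exact: measurable_kernel.
have := @cp_state_law _ _ _ _ _ _ _ _ S n setT B.
rewrite setTI; apply => //.
by apply: sub_sigma_algebra; left; exists n, setT; rewrite preimage_setT.
Qed.

End one_process.

End noise.

(** * Propagation of the discrepancy between two policies *)

Section comparison.
Context (R : realType) (dX dA dZ : measure_display).
Context (X : measurableType dX) (A : measurableType dA) (Z : measurableType dZ).
Context (m : probability Z R) (p : R.-pker (X * A)%type ~> X).
Context (f f' : X * Z -> A).
Local Open Scope ereal_scope.

Lemma kernel_le1 (u : X * A) (B : set X) : measurable B -> p u B <= 1.
Proof.
move=> mB; rewrite -(prob_kernel (s := p) u).
by apply: le_measure; rewrite ?inE.
Qed.

Lemma noise_mean_le (g : X * A -> \bar R) (e : R) x :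
  measurable_fun setT f -> measurable_fun setT f' -> measurable_fun setT g ->
  (0 <= e)%R -> (forall u, 0 <= g u) ->
  (forall z, g (x, f (x, z)) <= g (x, f' (x, z)) + e%:E) ->
  noise_mean m f g x <= noise_mean m f' g x + e%:E.
Proof.
move=> mf mf' mg e0 g0 gff'.
have mgx (h : X * Z -> A) : measurable_fun setT h ->
    measurable_fun setT (fun z => g (x, h (x, z))).
  move=> mh; apply: (measurableT_comp mg); apply: measurable_fun_pair => //.
  by apply: (measurableT_comp mh); exact: pair1_measurable.
apply: (@le_trans _ _ (\int[m]_z (g (x, f' (x, z)) + cst e%:E z))).
  apply: ge0_le_integral => //; first exact: mgx.
  by apply: emeasurable_funD => //; exact: mgx.
rewrite ge0_integralD//; last exact: mgx.
by rewrite integral_cst// [X in e%:E * X]probability_setT mule1.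
Qed.

Context (eta eta' : R.-pker X ~> A) (mu : probability X R).
Context (S : controlled_process p eta mu) (S' : controlled_process p eta' mu).
Context (f_eta : noise_map m f eta) (f_eta' : noise_map m f' eta').

(** Averaging over the noise turns g into a function of the state with values
in [0,M]; changing the state law then costs M delta, and changing f into f'
costs e. *)
Lemma state_action_mean_le n (g : X * A -> \bar R) (M e delta : R) :
  measurable_fun setT g -> (forall u, 0 <= g u <= M%:E) ->
  (0 <= e)%R -> (0 <= delta)%R ->
  (forall x z, g (x, f (x, z)) <= g (x, f' (x, z)) + e%:E) ->
  (forall B, measurable B -> state_law S n B <= state_law S' n B + delta%:E) ->
  \int[cp_prob S]_w g (cp_state S n w, cp_action S n w) <=
  \int[cp_prob S']_w g (cp_state S' n w, cp_action S' n w) +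
    (M * delta + e)%:E.
Proof.
move=> mg g0M e0 delta0 gff' SS'.
have g0 u : 0 <= g u by have /andP[] := g0M u.
have [mf _] := f_eta; have [mf' _] := f_eta'.
rewrite (integral_state_action S f_eta)// (integral_state_action S' f_eta')//.
have mm (h : X * Z -> A) : measurable_fun setT h ->
    measurable_fun setT (noise_mean m h g).
  by move=> mh; exact: measurable_noise_mean.
apply: (@le_trans _ _ (\int[state_law S' n]_x noise_mean m f g x +
    (M * delta)%:E)).
  apply: le_integral_setwise => //; first exact: mm.
  by move=> x; exact: noise_mean_bounds.
rewrite EFinD addeCA addeC leeD2l//.
apply: (@le_trans _ _
    (\int[state_law S' n]_x (noise_mean m f' g x + cst e%:E x))).
  apply: ge0_le_integral => //.
  - by move=> x _; exact: integral_ge0.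
  - exact: mm.
  - by apply: emeasurable_funD => //; exact: mm.
  - by move=> x _; exact: noise_mean_le.
rewrite ge0_integralD//; last 2 first.
- by move=> x _; exact: integral_ge0.
- exact: mm.
by rewrite integral_cst// [X in e%:E * X]probability_setT mule1.
Qed.

(** The two processes start from the same law, and each step adds e to the
discrepancy: apply [state_action_mean_le] to g = p(B|.), for which M = 1. *)
Lemma state_law_le (e : R) n : (0 <= e)%R ->
  (forall x z B, measurable B ->
    p (x, f (x, z)) B <= p (x, f' (x, z)) B + e%:E) ->
  forall B, measurable B ->
    state_law S n B <= state_law S' n B + (n%:R * e)%:E.
Proof.
move=> e0 pff'; elim: n => [|n IH] B mB.
  have -> : state_law S 0%N B = mu B by exact: cp_init.
  have -> : state_law S' 0%N B = mu B by exact: cp_init.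
  by rewrite mul0r adde0.
rewrite (state_law_next S f_eta)// (state_law_next S' f_eta')//.
have mpB : measurable_fun setT (fun u => p u B) by exact: measurable_kernel.
rewrite -(integral_state_action S f_eta)// -(integral_state_action S' f_eta')//.
rewrite (_ : n.+1%:R * e = 1 * (n%:R * e) + e)%R; last first.
  by rewrite -natr1 mulrDl !mul1r.
apply: (@state_action_mean_le n (fun u => p u B)) => //.
- by move=> u; rewrite measure_ge0/=; exact: kernel_le1.
- by rewrite mulr_ge0.
- by move=> x z; exact: pff'.
Qed.

End comparison.

(** * Discounted sums and running averages *)

Section sequences_of_costs.
Context (R : realType).

(** The subtracted term is the tail of the series from index N on, which makes
the identity provable by induction on N. *)
Lemma discounted_affine_sum (a b beta : R) (N : nat) : beta != 1 ->
  \sum_(0 <= k < N) beta ^+ k * (k%:R * a + b) =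
  a * beta / (1 - beta) ^+ 2 + b / (1 - beta) -
  beta ^+ N * (a * (N%:R / (1 - beta) + beta / (1 - beta) ^+ 2) +
    b / (1 - beta)).
Proof.
rewrite eq_sym -subr_eq0 => beta1.
elim: N => [|N IH]; first by rewrite big_geq// expr0 mulr0n; field.
by rewrite big_nat_recr//= IH (exprS beta) -natr1; field.
Qed.

Local Open Scope ereal_scope.

(** Compare the partial sums: the difference is at most the sum of the affine
errors, which increases to the stated constant. *)
Lemma discounted_series_le (u v : (\bar R)^nat) (a b beta : R) :
  (0 < beta < 1)%R -> (0 <= a)%R -> (0 <= b)%R ->
  (forall n, 0 <= u n) -> (forall n, 0 <= v n) ->
  (forall n, u n <= v n + (n%:R * a + b)%:E) ->
  \sum_(0 <= n <oo) (beta ^+ n)%:E * u n <=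
  \sum_(0 <= n <oo) (beta ^+ n)%:E * v n +
    (a * beta / (1 - beta) ^+ 2 + b / (1 - beta))%:E.
Proof.
move=> /andP[beta0 beta1] a0 b0 u0 v0 uv.
have bn0 n : 0 <= (beta ^+ n)%:E by rewrite lee_fin exprn_ge0// ltW.
have b1 : (0 < 1 - beta)%R by rewrite subr_gt0.
apply: lime_le; first by apply: is_cvg_nneseries => n _ _; rewrite mule_ge0.
apply: nearW => N.
apply: (@le_trans _ _ (\sum_(0 <= n < N) ((beta ^+ n)%:E * v n +
    (beta ^+ n * (n%:R * a + b))%:E))).
  apply: lee_sum => n _; rewrite EFinM -ge0_muleDr//.
    by rewrite lee_wpmul2l.
  by rewrite lee_fin addr_ge0// mulr_ge0.
rewrite big_split/=; apply: leeD.
  by apply: nneseries_lim_ge => n _ _; rewrite mule_ge0.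
rewrite sumEFin lee_fin discounted_affine_sum ?lt_eqF//.
have [beta0' b1'] := (ltW beta0, ltW b1).
rewrite gerBl; apply: mulr_ge0; first exact: exprn_ge0.
apply: addr_ge0; last exact: divr_ge0.
by apply: mulr_ge0 => //; apply: addr_ge0; apply: divr_ge0; rewrite ?exprn_ge0.
Qed.

(** There are N+1 terms but the divisor is N, so Cesaro's theorem is applied to
the first N terms and the remaining one, divided by N, vanishes. *)
Lemma limn_esup_average (r : R^nat) (L : R) : r @ \oo --> L ->
  limn_esup (fun N => (N%:R^-1)%:E * (\sum_(0 <= n < N.+1) r n)%:E) = L%:E.
Proof.
move=> rL.
pose avg (N : nat) : R := (N%:R^-1 * \sum_(0 <= n < N.+1) r n)%R.
have avgL : avg @ \oo --> L.
  suff : (fun N => avg N.+1) @ \oo --> L by rewrite cvg_shiftS.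
  have rS : (fun n => r n.+1) @ \oo --> L by rewrite cvg_shiftS.
  have -> : (fun N => avg N.+1) =
      (fun N => arithmetic_mean r N + harmonic N * r N.+1)%R.
    apply/funext => N; rewrite /avg /arithmetic_mean seriesEnat/=.
    by rewrite [in LHS]big_nat_recr//= mulrDr.
  rewrite -[L in _ --> L]addr0 -(mul0r L).
  by apply: cvgD; [exact: cesaro|apply: cvgM => //; exact: cvg_harmonic].
have avgEL : (fun N => (avg N)%:E) @ \oo --> L%:E.
  by apply: cvg_EFin => //; exact: nearW.
transitivity (limn (fun N => (avg N)%:E)); last exact/cvg_lim.
exact/is_cvg_limn_esupE/cvgP/avgEL.
Qed.

End sequences_of_costs.

(** * Realizing a policy by uniform noise *)

Section unit_interval_noise.
Context (R : realType) (dX : measure_display) (X : measurableType dX).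
Context (d : nat) (A : set 'rV[R]_d) (Ainf : infinite_set A).
Local Notation Act := (borel (subset_space Ainf)).
Local Notation I01 := (`[0%R, 1%R]%classic : set R).

Definition clamp01 (z : R) : R := Num.max 0 (Num.min z 1).

Lemma clamp01_itv z : I01 (clamp01 z).
Proof.
by rewrite /= in_itv/= /clamp01 le_max lexx/= ge_max ler01/= ge_min lexx orbT.
Qed.

Lemma clamp01_id z : I01 z -> clamp01 z = z.
Proof.
rewrite /= in_itv/= /clamp01 => /andP[z0 z1].
by rewrite (min_idPl z1) (max_idPr z0).
Qed.

Lemma measurable_clamp01 : measurable_fun [set: R] clamp01.
Proof.
apply: measurable_maxr; first exact: measurable_cst.
by apply: measurable_minr; [exact: measurable_id|exact: measurable_cst].
Qed.

(** The type forces the probability structure on the uniform law. *)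
Definition uniform01 : probability (measurableTypeR R) R :=
  uniform_prob (@ltr01 R).

Lemma uniform01E (U : set R) : measurable U ->
  uniform01 U = lebesgue_measure (U `&` I01).
Proof.
move=> mU; rewrite /uniform01/= /uniform_prob integral_uniform_pdf.
rewrite (eq_integral (cst 1%E)); last first.
  move=> z; rewrite inE => -[_]; rewrite /= in_itv/= => z01.
  by rewrite /uniform_pdf z01 subr0 invr1.
by rewrite integral_cst ?mul1e//; apply: measurableI => //; exact: measurable_itv.
Qed.

(** A representation is measurable on X x [0,1] only; precomposing with the
projection onto [0,1] gives a function measurable everywhere, with the same
law under uniform noise. *)
Definition extend01 (f : X * measurableTypeR R -> Act) :
  X * measurableTypeR R -> Act := fun u => f (u.1, clamp01 u.2).

Lemma noise_map_extend01 (f : X * measurableTypeR R -> Act)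
    (eta : R.-pker X ~> Act) :
  represents f eta -> noise_map uniform01 (extend01 f) eta.
Proof.
move=> [mf etaE]; have mef : measurable_fun setT (extend01 f).
  apply: (measurable_comp (F := [set: X] `*` I01)
    (g := fun u : X * measurableTypeR R => (u.1, clamp01 u.2))) => //.
  - by apply: measurableX => //; exact: measurable_itv.
  - by move=> _ [u _ <-]; split => //; exact: clamp01_itv.
  - apply: measurable_fun_pair => //.
    exact: measurableT_comp measurable_clamp01 _.
split=> // x E mE; rewrite etaE//.
rewrite uniform01E; last first.
  rewrite -[X in measurable X]setTI.
  by apply: (measurableT_comp mef (pair1_measurable x)).
congr (lebesgue_measure _); apply/seteqP; split => z /=.
  by move=> [z01 Ez]; split => //; rewrite /extend01/= clamp01_id.
by move=> [Ez z01]; split => //; move: Ez; rewrite /extend01/= clamp01_id.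
Qed.

(** The Dirac mass at q(x,z) charges E exactly when q(x,z) lies in E, so the
integral in the definition of the quantized kernel is a Lebesgue measure. *)
Lemma represents_induced_by (q : X * measurableTypeR R -> Act)
    (eta : R.-pker X ~> Act) :
  measurable_fun ([set: X] `*` I01) q -> induced_by q eta -> represents q eta.
Proof.
move=> mq etaE; split => // x E mE; rewrite etaE//.
have mI : measurable I01 by exact: measurable_itv.
have mqx : measurable_fun I01 (fun z => q (x, z)).
  apply: (measurable_comp (F := [set: X] `*` I01)
    (g := fun z : measurableTypeR R => (x, z))) => //.
  - exact: measurableX.
  - by move=> _ [z z01 <-].
  - by apply: measurable_funTS; exact: pair1_measurable.
have mU : measurable [set z | I01 z /\ E (q (x, z))] by exact: mqx.
pose U : set (measurableTypeR R) := [set z | I01 z /\ E (q (x, z))].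
transitivity (\int[lebesgue_measure]_(z in I01) (\1_U z)%:E)%E; last first.
  by rewrite integral_indic// setIidl// => z [].
apply: eq_integral => z; rewrite inE => z01; rewrite diracE indicE.
congr ((nat_of_bool _)%:R%:E).
by apply/idP/idP; rewrite !inE /U /= => // -[].
Qed.

End unit_interval_noise.

(** * Expected stage costs *)

Section costs.
Context (R : realType) (dX dA : measure_display).
Context (X : measurableType dX) (A : measurableType dA).
Context (p : R.-pker (X * A)%type ~> X) (eta : R.-pker X ~> A).
Context (mu : probability X R) (S : controlled_process p eta mu).
Context (c : X * A -> R) (c_meas : measurable_fun setT c).
Context (c_ge0 : forall u, 0 <= c u).
Local Open Scope ereal_scope.

Definition stage_cost (n : nat) : \bar R :=
  \int[cp_prob S]_w (c (cp_state S n w, cp_action S n w))%:E.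

Let measurable_stage n : measurable_fun setT
  (fun w => (c (cp_state S n w, cp_action S n w))%:E).
Proof.
apply/measurable_EFinP.
by apply: (measurableT_comp c_meas); apply: measurable_fun_pair.
Qed.

Lemma stage_cost_ge0 n : 0 <= stage_cost n.
Proof. by apply: integral_ge0 => w _; rewrite lee_fin. Qed.

Lemma stage_cost_le M n : (forall u, c u <= M)%R -> stage_cost n <= M%:E.
Proof.
move=> cM; apply: (@le_trans _ _ (\int[cp_prob S]_w cst M%:E w)).
  apply: ge0_le_integral => //; first by move=> w _; rewrite lee_fin.
  by move=> w _; rewrite lee_fin.
by rewrite integral_cst// [X in _ * X]probability_setT mule1.
Qed.

Lemma w_betaE beta : (0 <= beta)%R ->
  w_beta c beta S = \sum_(0 <= n <oo) (beta ^+ n)%:E * stage_cost n.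
Proof.
move=> beta0; rewrite /w_beta integral_nneseries//.
- apply: eq_eseriesr => n _; under eq_integral do rewrite EFinM.
  by rewrite ge0_integralZl// ?lee_fin ?exprn_ge0// => w _; rewrite lee_fin.
- move=> n; under eq_fun do rewrite EFinM.
  exact: measurable_funeM.
- by move=> n w _; rewrite lee_fin mulr_ge0// exprn_ge0.
Qed.

Lemma w_AE (r : nat -> R) : (forall n, stage_cost n = (r n)%:E) ->
  w_A c S =
  limn_esup (fun N => (N%:R^-1)%:E * (\sum_(0 <= n < N.+1) r n)%:E).
Proof.
move=> rE; rewrite /w_A; congr limn_esup; apply/funext => N; congr (_ * _).
under eq_integral do rewrite -sumEFin.
rewrite ge0_integral_sum//; last by move=> n w _; rewrite lee_fin.
by rewrite -sumEFin; apply: eq_bigr => n _; exact: rE.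
Qed.

(** L is the integral against nu of the mean cost of the policy, so the layer
cake bound applies to the laws of x_n and to nu; the expected costs converge
to L, and so do their running averages. *)
Lemma ergodic_cost (dZ : measure_display) (Z : measurableType dZ)
    (m : probability Z R) (f : X * Z -> A) (nu : probability X R)
    (C kappa M : R) :
  noise_map m f eta -> (forall u, c u <= M)%R ->
  (0 <= C)%R -> (0 < kappa < 1)%R ->
  (forall n, (1 <= n)%N ->
    tv_dist (state_law S n) nu <= (C * kappa ^+ n)%:E) ->
  exists2 L : R, w_A c S = L%:E &
    forall n, (1 <= n)%N ->
      stage_cost n <= L%:E + (M * (C / 2 * kappa ^+ n))%:E /\
      L%:E <= stage_cost n + (M * (C / 2 * kappa ^+ n))%:E.
Proof.
move=> f_eta cM C0 /andP[kappa0 kappa1] tvS.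
have [mf _] := f_eta.
have mEc : measurable_fun setT (EFin \o c) by exact/measurable_EFinP.
have c0M u : 0 <= (EFin \o c) u <= M%:E by rewrite /= !lee_fin c_ge0 cM.
have c0 u : 0 <= (EFin \o c) u by rewrite /= lee_fin.
have G0M x := noise_mean_bounds m x mf mEc c0M.
have mG := measurable_noise_mean m mf mEc c0.
have [L LE] : exists L : R, \int[nu]_x noise_mean m f (EFin \o c) x = L%:E.
  have : \int[nu]_x noise_mean m f (EFin \o c) x <= M%:E.
    apply: (@le_trans _ _ (\int[nu]_x cst M%:E x)).
      apply: ge0_le_integral => // x _; by have /andP[] := G0M x.
    by rewrite integral_cst// [X in _ * X]probability_setT mule1.
  have : 0 <= \int[nu]_x noise_mean m f (EFin \o c) x.
    by apply: integral_ge0 => x _; have /andP[] := G0M x.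
  by case: (integral _ _ _) => // L; exists L.
have near_L n : (1 <= n)%N ->
    stage_cost n <= L%:E + (M * (C / 2 * kappa ^+ n))%:E /\
    L%:E <= stage_cost n + (M * (C / 2 * kappa ^+ n))%:E.
  move=> n1; rewrite -LE.
  have -> : stage_cost n = \int[state_law S n]_x noise_mean m f (EFin \o c) x.
    exact: (integral_state_action S f_eta).
  have tvn : tv_dist (state_law S n) nu <= (2 * (C / 2 * kappa ^+ n))%:E.
    by rewrite (_ : 2 * _ = C * kappa ^+ n)%R; [exact: tvS|field].
  have d0 : (0 <= C / 2 * kappa ^+ n)%R.
    by rewrite mulr_ge0 ?divr_ge0// exprn_ge0// ltW.
  have near_nu B (mB : measurable B) := tv_dist_setwise
    (fin_num_measure (state_law S n) B mB) (fin_num_measure nu B mB) tvn mB.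
  by split; apply: le_integral_setwise => // B mB; have [] := near_nu B mB.
exists L => //.
have fin n : stage_cost n = (fine (stage_cost n))%:E.
  rewrite fineK// ge0_fin_numE ?stage_cost_ge0//.
  exact: le_lt_trans (stage_cost_le n cM) (ltry _).
rewrite (w_AE fin); apply: limn_esup_average.
have cvgk a : (fun n => a * (M * (C / 2 * kappa ^+ n)) + L)%R @ \oo --> L.
  rewrite -[L in _ --> L]add0r; apply: cvgD; last exact: cvg_cst.
  have : geometric (a * M * (C / 2))%R kappa @ \oo --> (0 : R)%R.
    by apply: cvg_geometric; rewrite gtr0_norm.
  apply: cvg_trans; apply: near_eq_cvg; apply: nearW => n /=; ring.
apply: squeeze_cvgr (cvgk (-1)%R) (cvgk 1%R); near=> n.
have [|] := near_L n; first by near: n; exact: nbhs_infty_gt.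
rewrite fin -!EFinD !lee_fin => ? ?; apply/andP; split; lra.
Unshelve. all: by end_near. Qed.

End costs.

(** * Policies with uniformly close actions *)

Section quantized_policy.
Context (R : realType) (dX : measure_display) (X : measurableType dX).
Context (d : nat) (A : set 'rV[R]_d) (Ainf : infinite_set A).
Local Notation Act := (borel (subset_space Ainf)).
Context (p : R.-pker (X * Act)%type ~> X) (c : X * Act -> R) (M K1 K2 rho : R).
Context (c_meas : measurable_fun setT c) (c_ge0 : forall u, 0 <= c u).
Context (c_le : forall u, c u <= M) (K1_ge0 : 0 <= K1) (K2_ge0 : 0 <= K2).
Context (c_lip : forall (x : X) (a b : Act),
  `|c (x, b) - c (x, a)| <= K1 * dist_sub Ainf b a).
Context (p_lip : forall (x : X) (a b : Act),
  (tv_dist (p (x, b)) (p (x, a)) <= (K2 * dist_sub Ainf b a)%:E)%E).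
Context (f f' : X * measurableTypeR R -> Act) (eta eta' : R.-pker X ~> Act).
Context (f_eta : noise_map (uniform01 R) f eta).
Context (f_eta' : noise_map (uniform01 R) f' eta').
Context (rho_ge0 : 0 <= rho).
Context (ff' : forall u, dist_sub Ainf (f u) (f' u) <= rho).

(** The total variation bound on p enters with the factor 1/2, as a bound on
each set; the two inequalities exchange the roles of f and f'. *)
Lemma stage_cost_close (mu : probability X R) (S : controlled_process p eta mu)
    (S' : controlled_process p eta' mu) (n : nat) :
  (stage_cost S c n <= stage_cost S' c n +
     (n%:R * (M * (K2 * rho / 2)) + K1 * rho)%:E)%E /\
  (stage_cost S' c n <= stage_cost S c n +
     (n%:R * (M * (K2 * rho / 2)) + K1 * rho)%:E)%E.
Proof.
have d0 : 0 <= K2 * rho / 2 by rewrite divr_ge0// mulr_ge0.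
have nd0 : 0 <= n%:R * (K2 * rho / 2) by rewrite mulr_ge0.
have e0 : 0 <= K1 * rho by rewrite mulr_ge0.
have Mn : n%:R * (M * (K2 * rho / 2)) = M * (n%:R * (K2 * rho / 2)) by ring.
have mEc : measurable_fun setT (EFin \o c) by exact/measurable_EFinP.
have c0M u : (0 <= (EFin \o c) u <= M%:E)%E by rewrite /= !lee_fin c_ge0 c_le.
have c_close x z : `|c (x, f (x, z)) - c (x, f' (x, z))| <= K1 * rho.
  by apply: le_trans (c_lip _ _ _) _; rewrite ler_wpM2l.
have p_fin u B : measurable B -> p u B \is a fin_num.
  move=> mB; rewrite ge0_fin_numE//.
  exact: le_lt_trans (kernel_le1 p u mB) (ltry _).
have p_close x z B : measurable B ->
    (p (x, f (x, z)) B <= p (x, f' (x, z)) B + (K2 * rho / 2)%:E)%E /\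
    (p (x, f' (x, z)) B <= p (x, f (x, z)) B + (K2 * rho / 2)%:E)%E.
  move=> mB; apply: tv_dist_setwise => //; try exact: p_fin.
  apply: le_trans (p_lip _ _ _) _; rewrite lee_fin mulrCA divff ?mulr1//.
  by rewrite ler_wpM2l.
rewrite Mn; split.
- apply: (state_action_mean_le (S := S) (S' := S') f_eta f_eta' (n := n)
    (g := EFin \o c)) => //.
    move=> x z; have := c_close x z; rewrite ler_norml -EFinD lee_fin; lra.
  apply: (state_law_le S S' f_eta f_eta') => // x z B mB.
  by have [] := p_close x z B mB.
- apply: (state_action_mean_le (S := S') (S' := S) f_eta' f_eta (n := n)
    (g := EFin \o c)) => //.
    move=> x z; have := c_close x z; rewrite ler_norml -EFinD lee_fin; lra.
  apply: (state_law_le S' S f_eta' f_eta) => // x z B mB.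
  by have [] := p_close x z B mB.
Qed.

(** Term by term comparison of the discounted series. Finiteness, without which
the difference is meaningless, comes from comparing with the zero series. *)
Lemma discounted_cost_close (mu : probability X R) (beta : R)
    (S : controlled_process p eta mu) (S' : controlled_process p eta' mu) :
  0 < beta < 1 ->
  (`|w_beta c beta S - w_beta c beta S'| <=
    (M * (K2 * rho / 2) * beta / (1 - beta) ^+ 2 +
      K1 * rho / (1 - beta))%:E)%E.
Proof.
move=> /[dup] beta01 /andP[/ltW beta0 beta1].
have M0 : 0 <= M by apply: le_trans (c_le point); exact: c_ge0.
have a0 : 0 <= M * (K2 * rho / 2).
  by rewrite mulr_ge0// divr_ge0// mulr_ge0.
have b0 : 0 <= K1 * rho by rewrite mulr_ge0.
rewrite !w_betaE//.
have u0 := stage_cost_ge0 S c_ge0; have v0 := stage_cost_ge0 S' c_ge0.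
have bn0 n : (0 <= (beta ^+ n)%:E)%E by rewrite lee_fin exprn_ge0.
apply: lee_abse_sub.
- rewrite ge0_fin_numE; last by apply: nneseries_ge0 => n _ _; rewrite mule_ge0.
  have stage_le n : (stage_cost S' c n <= 0%E + (n%:R * 0 + M)%:E)%E.
    by rewrite mulr0 add0e add0r; exact: stage_cost_le.
  have := discounted_series_le beta01 (lexx 0) M0 v0 (fun=> lexx _) stage_le.
  rewrite [X in (_ <= X + _)%E]eseries0 => [|n _ _]; last by rewrite mule0.
  by move=> /le_lt_trans -> //; rewrite add0e ltry.
- by apply: nneseries_ge0 => n _ _; rewrite mule_ge0.
- by apply: discounted_series_le => // n; have [] := stage_cost_close S S' n.
- by apply: discounted_series_le => // n; have [] := stage_cost_close S S' n.
Qed.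

(** Pass from each average cost to the expected cost at time n, where the two
policies can be compared. *)
Lemma average_cost_close (mu : probability X R) (C kappa : R) (n : nat)
    (S : controlled_process p eta mu) (S' : controlled_process p eta' mu)
    (nu nu' : probability X R) :
  0 <= C -> 0 < kappa < 1 ->
  (forall l, (1 <= l)%N ->
    (tv_dist (state_law S l) nu <= (C * kappa ^+ l)%:E)%E) ->
  (forall l, (1 <= l)%N ->
    (tv_dist (state_law S' l) nu' <= (C * kappa ^+ l)%:E)%E) ->
  (1 <= n)%N ->
  (`|w_A c S - w_A c S'| <=
    (M * C * kappa ^+ n + (n%:R * (M * (K2 * rho / 2)) + K1 * rho))%:E)%E.
Proof.
move=> C0 kappa01 tvS tvS' n1.
have [L -> /(_ n n1)] := ergodic_cost c_meas c_ge0 f_eta c_le C0 kappa01 tvS.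
have [L' -> /(_ n n1)] := ergodic_cost c_meas c_ge0 f_eta' c_le C0 kappa01 tvS'.
have fin eta0 (S0 : controlled_process p eta0 mu) :
    stage_cost S0 c n \is a fin_num.
  rewrite ge0_fin_numE ?stage_cost_ge0//.
  exact: le_lt_trans (stage_cost_le S0 c_meas c_ge0 n c_le) (ltry _).
have := stage_cost_close S S' n.
rewrite -(fineK (fin _ S)) -(fineK (fin _ S')) -!EFinD !lee_fin.
set t := kappa ^+ n.
rewrite (_ : M * (C / 2 * t) = M * C * t / 2); last by field.
by move=> [? ?] [? ?] [? ?]; rewrite ler_norml; apply/andP; split; lra.
Qed.

End quantized_policy.

(** * Approximation by quantized policies *)

Theorem theoremV2 (R : realType)
    (X : ptopologicalType) (X_polish : polish_space R X)
    (d : nat) (d_ge1 : (1 <= d)%N)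
    (A : set 'rV[R]_d) (A_inf : infinite_set A) (A_compact : compact A)
    (p : R.-pker (borel X * borel (subset_space A_inf))%type ~> borel X)
    (c : borel X * borel (subset_space A_inf) -> R)
    (c_meas : measurable_fun setT c)
    (c_ge0 : forall z, 0 <= c z)
    (c_bounded : has_ubound (range (fun z => `|c z|)))
    (K1 : R) (K1_ge0 : 0 <= K1)
    (c_lip : forall (x : X) (a b : subset_space A_inf),
       `|c (x, b) - c (x, a)| <= K1 * dist_sub A_inf b a)
    (K2 : R) (K2_ge0 : 0 <= K2)
    (p_lip : forall (x : X) (a b : subset_space A_inf),
       (tv_dist (p (x, b)) (p (x, a)) <= (K2 * dist_sub A_inf b a)%:E)%E)
    (alpha : R) (alpha_gt0 : 0 < alpha)
    (Lambda : nat -> set (borel (subset_space A_inf)))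
    (Lambda_net : quantization_nets alpha Lambda)
    (eta : R.-pker (borel X) ~> (borel (subset_space A_inf)))
    (f : borel X * measurableTypeR R -> borel (subset_space A_inf))
    (f_eta : represents f eta)
    (q : nat -> borel X * measurableTypeR R -> borel (subset_space A_inf))
    (q_quant : forall k, (1 <= k)%N -> quantizer (Lambda k) f (q k))
    (eta_q : nat -> R.-pker (borel X) ~> (borel (subset_space A_inf)))
    (eta_q_ind : forall k, (1 <= k)%N -> induced_by (q k) (eta_q k)) :
  let M := sup (range (fun z => `|c z|)) in
  (forall (beta : R), 0 < beta < 1 ->
   forall (mu : probability (borel X) R) (k : nat), (1 <= k)%N ->
   forall (S : controlled_process p eta mu)
          (Sk : controlled_process p (eta_q k) mu),
   let K := alpha / (1 - beta) *
            (K1 - beta * K2 * M + 2 * beta * M * K2 / (1 - beta)) in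
   (`|w_beta c beta S - w_beta c beta Sk| <=
      (K * (1 / k%:R) `^ (1 / d%:R))%:E)%E)
  /\
  (forall (C kappa : R), 0 < C -> 0 < kappa < 1 ->
   (forall eta' : R.-pker (borel X) ~> (borel (subset_space A_inf)),
    exists nu : probability (borel X) R,
    forall (x : borel X) (n : nat), (1 <= n)%N ->
    forall S : controlled_process p eta' \d_x,
    (tv_dist (state_law S n) nu <= (C * kappa ^+ n)%:E)%E) ->
   forall (x : borel X) (k n : nat), (1 <= k)%N -> (1 <= n)%N ->
   forall (S : controlled_process p eta \d_x)
          (Sk : controlled_process p (eta_q k) \d_x),
   (`|w_A c S - w_A c Sk| <=
      (2 * M * C * kappa ^+ n +
       ((2 * n%:R - 1) * K2 * alpha * M + K1 * alpha) *
         (1 / k%:R) `^ (1 / d%:R))%:E)%E).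
Proof.
move=> M.
have c_le z : c z <= M.
  by apply: le_trans (ler_norm _) _; apply: ub_le_sup => //; exists z.
have M_ge0 : 0 <= M by apply: le_trans (c_le point).
have rho_ge0 (k : nat) : 0 <= alpha * (1 / k%:R) `^ (1 / d%:R).
  by rewrite mulr_ge0 ?powR_ge0// ltW.
have f_noise := noise_map_extend01 f_eta.
have q_noise k : (1 <= k)%N ->
    noise_map (uniform01 R) (extend01 (q k)) (eta_q k).
  move=> k1; apply: noise_map_extend01; apply: represents_induced_by.
    by have [] := q_quant k k1.
  exact: eta_q_ind.
have fq k : (1 <= k)%N -> forall u, dist_sub A_inf (extend01 f u)
    (extend01 (q k) u) <= alpha * (1 / k%:R) `^ (1 / d%:R).
  move=> k1 [x z]; have [_ qmin] := q_quant k k1.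
  have [_ qle] := qmin x _ (clamp01_itv z).
  have [_ /(_ (f (x, clamp01 z)))[b Lb fb]] := Lambda_net k k1.
  exact: le_trans (qle b Lb) fb.
split.
- move=> beta beta01 mu k k1 S Sk /=.
  apply: le_trans (discounted_cost_close c_meas c_ge0 c_le K1_ge0 K2_ge0
    c_lip p_lip f_noise (q_noise k k1) (rho_ge0 k) (fq k k1) S Sk beta01) _.
  rewrite lee_fin; have /andP[beta0 beta1] := beta01.
  have r0 : 0 <= (1 / k%:R) `^ (1 / d%:R) :> R by exact: powR_ge0.
  set r := (1 / k%:R) `^ _ in r0 *.
  have b1 : 1 - beta != 0 by rewrite subr_eq0 gt_eqF.
  (* the constant K r minus the bound just obtained, in factored form *)
  rewrite -subr_ge0 (_ : _ - _ =
    alpha * r * (M * K2) * beta * (2^-1 + beta) / (1 - beta) ^+ 2).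
    rewrite divr_ge0 ?exprn_ge0 ?subr_ge0 ?(ltW beta1)//.
    rewrite !mulr_ge0 ?addr_ge0 ?invr_ge0//; exact: ltW.
  by field.
- move=> C kappa C0 kappa01 erg x k n k1 n1 S Sk.
  have [nu tvS] := erg eta; have [nuk tvSk] := erg (eta_q k).
  apply: le_trans (average_cost_close c_meas c_ge0 c_le K1_ge0 K2_ge0
    c_lip p_lip f_noise (q_noise k k1) (rho_ge0 k) (fq k k1)
    (ltW C0) kappa01 (fun l l1 => tvS x l l1 S) (fun l l1 => tvSk x l l1 Sk)
    n1) _.
  rewrite lee_fin; have /andP[kappa0 _] := kappa01.
  set r := (1 / k%:R) `^ _.
  have r0 : 0 <= r by exact: powR_ge0.
  have t0 : 0 <= M * C * kappa ^+ n.
    by rewrite !mulr_ge0 ?exprn_ge0// ltW.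
  have s0 : 0 <= M * K2 * alpha * r by rewrite !mulr_ge0// ltW.
  have n1R : 1 <= n%:R :> R by rewrite ler1n.
  (* 3n/2 - 1 is the difference of the coefficients 2n - 1 and n/2 *)
  have : 0 <= (n%:R * (3 / 2) - 1) * (M * K2 * alpha * r).
    by apply: mulr_ge0 => //; lra.
  lra.
Qed.
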